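(* Let $n, K, M$ be integers with $n=KM$, $K\ge 2$, $M \ge 1$, and consider the corrupted parallel mixnet process on $n$ cards with $M$ servers, each handling $K$ cards per round, of which $s$ servers are non-corrupted ($1\le s\le M$) and $M-s$ are corrupted, with potential $\Phi(t)=\left(\sum_{i=1}^n w_i(t)^2\right)-\frac1n$ after $t$ rounds. Let $b\ge 1$ be fixed. (i) If $s \ge \epsilon\,\frac{n-1}{K-1}$ for some $\epsilon\ge 1/2$, then after $t=\lceil b\log_2 n\rceil$ rounds, $\mathbf{E}[\Phi(t)]\le 1/n^b$. (ii) If $K\ge n^{1/c}$ for some constant $c\ge 1$ and the number $M-s$ of corrupted servers is at most $$\frac{n^{-1/c}(n-1)}{K-1}-\frac{n-K}{K(K-1)},$$ then after $t=\lceil bc\rceil$ rounds, $\mathbf{E}[\Phi(t)]\le 1/n^b$.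
   Context: Corrupted parallel mixnet (no fake messages): there are $n$ cards (messages) and $M=n/K$ servers, of which a fixed set of $s$ servers is non-corrupted and the other $M-s$ are corrupted. In each round, (1) the cards are placed in order according to a uniformly random permutation, independent of all previous randomness, which the adversary sees; (2) under this ordering the cards are divided into $M$ consecutive groups of $K$ cards, one group per server; (3) each server permutes its $K$ cards uniformly at random; the permutation is hidden from the adversary if the server is non-corrupted and is revealed to the adversary if the server is corrupted. A corrupted server's permutation is treated as the identity, since the adversary can undo it. The adversary knows the initial ordering. $w_i(t)$ is the probability, from the point of view of the adversary, that the card in position $i$ after $t$ rounds is the card that was first at time $0$. Concretely, $w(0)=(1,0,\dots,0)$, and $w(t+1)$ is obtained from $w(t)$ by permuting the entries by a fresh uniformly random permutation of the $n$ positions, splitting the positions into $M$ consecutive blocks of size $K$ (one per server), replacing every entry in each block belonging to a non-corrupted server by the average of the $K$ entries of that block, and leaving the entries in blocks of corrupted servers unchanged. The sum-of-squares error between the card-assignment probabilities and the uniform distribution is $\Phi(t)=\sum_{i=1}^n (w_i(t)-1/n)^2 = \left(\sum_{i=1}^n w_i(t)^2\right)-1/n$. It is a random variable depending on the visible random permutations; $\mathbf{E}$ is expectation over these. *)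

(* Defs.v *)
From HB Require Import structures.
From mathcomp Require Import all_boot all_order all_algebra all_fingroup.
From mathcomp Require Import all_classical all_reals all_analysis.

Set Implicit Arguments.
Unset Strict Implicit.
Unset Printing Implicit Defensive.

Import Order.TTheory GRing.Theory Num.Theory.

Local Open Scope ring_scope.

Section Mixnet.
Context {R : realType}.
Variables (n K M : nat).

(* Card positions and servers are numbered from 0: after the random ordering,
   server m receives the positions m * K, ..., m * K + K - 1, so the server
   handling position i is i %/ K. The set H contains the non-corrupted
   servers; all the others are corrupted. *)
Definition in_honest_block (H : {set 'I_M}) (i : 'I_n) : bool :=
  [exists m in H, (i %/ K == m)%N].

Definition block_average (w : 'I_n -> R) (i : 'I_n) : R :=
  (\sum_(j < n | (j %/ K == i %/ K)%N) w j) / K%:R.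

(* The effect of one round on the adversary's probabilities, when p is the
   public ordering of that round. The permutation of a corrupted server is
   revealed and undone by the adversary, hence counts as the identity. *)
Definition mix_round (H : {set 'I_M}) (w : 'I_n -> R) (p : 'S_n) : 'I_n -> R :=
  let v := fun i => w (p i) in
  fun i => if in_honest_block H i then block_average v i else v i.

Definition initial_weight : 'I_n -> R := fun i => ((i : nat) == 0%N)%:R.

(* mixnet_weight H ps is w(t), where t is the length of ps and ps lists the
   public orderings of the rounds 1, ..., t. *)
Definition mixnet_weight (H : {set 'I_M}) (ps : seq 'S_n) : 'I_n -> R :=
  foldl (mix_round H) initial_weight ps.

Definition potential (w : 'I_n -> R) : R := \sum_(i < n) w i ^+ 2 - n%:R^-1.

End Mixnet.

Definition uniform_expectation {R : realType} (T : finType) (X : T -> R) : R :=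
  (\sum_(x : T) X x) / #|T|%:R.

(* The public orderings of t rounds are independent and uniform in 'S_n, that
   is, they form a uniformly random t-tuple of permutations. *)
Definition expected_potential (R : realType) (n K M : nat) (H : {set 'I_M})
    (t : nat) : R :=
  uniform_expectation
    (fun ps : t.-tuple 'S_n => potential (mixnet_weight K H ps)).

Definition log2 {R : realType} (x : R) : R := ln x / ln 2.

(* A ceiling with values in nat, meaningful for x >= 0 only. *)
Definition ceiln {R : realType} (x : R) : nat := `|Num.ceil x|%N.

(* Main.v *)
(* For a uniformly random ordering the moments E[w_(p i)^2] and, for i != j,
   E[w_(p i) w_(p j)] do not depend on i and j. Hence one round multiplies the
   conditional expectation of the potential by exactly
   rho = 1 - s (K - 1) / (n - 1), and E[Phi(t)] = rho^t (1 - 1/n).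
   With n = K M, each of the two hypotheses gives rho <= n^(-1/c),
   where c = log2 n in case (i). *)
Require Import Defs.
From mathcomp Require Import all_boot all_order all_algebra all_fingroup.
From mathcomp Require Import all_classical all_reals all_analysis.
From mathcomp Require Import ring lra.

Import Order.TTheory GRing.Theory Num.Theory.
Local Open Scope ring_scope.

(** * Finite uniform expectations *)

Section UniformExpectation.
Context {R : realType}.

Lemma eq_uniform_expectation {T : finType} (X Y : T -> R) :
  X =1 Y -> uniform_expectation X = uniform_expectation Y.
Proof. by move=> XY; congr (_ / _); apply: eq_bigr => x _. Qed.

Lemma uniform_expectation_const {T : finType} (x0 : T) (a : R) :
  uniform_expectation (fun _ : T => a) = a.
Proof.
rewrite /uniform_expectation sumr_const -[X in X / _]mulr_natr mulfK// pnatr_eq0 -lt0n.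
by apply/card_gt0P; exists x0.
Qed.

Lemma uniform_expectation_sum {T I : finType} (P : pred I) (X : I -> T -> R) :
  uniform_expectation (fun x => \sum_(i | P i) X i x) =
  \sum_(i | P i) uniform_expectation (X i).
Proof. by rewrite /uniform_expectation exchange_big mulr_suml. Qed.

Lemma uniform_expectationZ {T : finType} (a : R) (X : T -> R) :
  uniform_expectation (fun x => a * X x) = a * uniform_expectation X.
Proof. by rewrite /uniform_expectation -mulr_sumr mulrA. Qed.

Lemma uniform_expectationB {T : finType} (X Y : T -> R) :
  uniform_expectation (fun x => X x - Y x) =
  uniform_expectation X - uniform_expectation Y.
Proof. by rewrite /uniform_expectation sumrB mulrBl. Qed.

Lemma uniform_expectation_reindex {T : finType} {h : T -> T} {X : T -> R} :
  injective h -> uniform_expectation (fun x => X (h x)) = uniform_expectation X.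
Proof. by move=> hI; congr (_ / _); rewrite [RHS](reindex_inj hI). Qed.

(** Independence of the rounds: conditioning on the first one leaves the others uniform, since
    [cons_tuple] is a bijection and the cardinals multiply. *)
Lemma uniform_expectation_tupleS {T : finType} (t : nat)
    (X : t.+1.-tuple T -> R) :
  uniform_expectation X =
  uniform_expectation (fun x =>
    uniform_expectation (fun ps : t.-tuple T => X (cons_tuple x ps))).
Proof.
rewrite /uniform_expectation -mulr_suml -mulrA; congr (_ * _); last first.
  by rewrite !card_tuple expnS natrM invfM mulrC.
rewrite pair_bigA /= (reindex (fun xp : T * t.-tuple T => cons_tuple xp.1 xp.2)) //.
exists (fun ps => (thead ps, behead_tuple ps)) => [[x ps] _|ps _] /=.
  by congr (_, _); apply: val_inj.
by rewrite [RHS]tuple_eta; apply: val_inj.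
Qed.

End UniformExpectation.

(** * Moments of a function along a uniformly random permutation *)

Section PermutationMoments.
Context {R : realType} {T : finType}.
Implicit Types (f w : T -> R) (i j : T).

Lemma sum_comp_perm f (p : {perm T}) : \sum_i f (p i) = \sum_i f i.
Proof. by rewrite [RHS](reindex_inj (@perm_inj _ p)). Qed.

(** Multiplication by the transposition of [i] and [k] preserves the uniform measure, so all points
    have the same expectation; their total is the constant [\sum_j f j]. *)
Lemma expectation_perm f i :
  uniform_expectation (fun p : {perm T} => f (p i)) = (\sum_j f j) / #|T|%:R.
Proof.
have sym k : uniform_expectation (fun p : {perm T} => f (p k)) =
             uniform_expectation (fun p : {perm T} => f (p i)).
  rewrite -[RHS](uniform_expectation_reindex (mulgI (tperm i k))).
  by apply: eq_uniform_expectation => p; rewrite permM tpermL.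
have T0 : #|T|%:R != 0 :> R by rewrite pnatr_eq0 -lt0n; apply/card_gt0P; exists i.
apply: (mulIf T0); rewrite divfK// mulr_natr -sumr_const.
under eq_bigr => k _ do rewrite -(sym k).
rewrite -uniform_expectation_sum.
under eq_uniform_expectation => p do rewrite sum_comp_perm.
exact: (uniform_expectation_const (1%g : {perm T})).
Qed.

(* By symmetry the mixed moments with [j <> i] all agree; their sum over [j],
   diagonal term included, is determined because [\sum_j w (p j)] is constant. *)
Lemma expectation_perm_mixed w i j : i != j ->
  uniform_expectation (fun p : {perm T} => w (p i) * w (p j)) =
  ((\sum_k w k) ^+ 2 - \sum_k w k ^+ 2) / (#|T|%:R * (#|T|%:R - 1)).
Proof.
move=> ij.
have sym k : k != i ->
    uniform_expectation (fun p : {perm T} => w (p i) * w (p k)) =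
    uniform_expectation (fun p : {perm T} => w (p i) * w (p j)).
  move=> ki; rewrite -[RHS](uniform_expectation_reindex (mulgI (tperm j k))).
  apply: eq_uniform_expectation => p.
  by rewrite !permM tpermL tpermD// eq_sym.
have T2 : (1 < #|T|)%N.
  by rewrite (cardD1 i) (cardD1 j) !inE eq_sym ij.
have T0 : #|T|%:R != 0 :> R by rewrite pnatr_eq0 -lt0n ltnW.
have T1 : #|T|%:R - 1 != 0 :> R by rewrite subr_eq0 pnatr_eq1 gtn_eqF.
have total : \sum_k uniform_expectation (fun p : {perm T} => w (p i) * w (p k))
           = (\sum_k w k) ^+ 2 / #|T|%:R.
  rewrite -uniform_expectation_sum.
  under eq_uniform_expectation => p do
    rewrite -mulr_sumr (sum_comp_perm w p) mulrC.
  by rewrite uniform_expectationZ expectation_perm expr2 mulrA.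
move: total; rewrite (bigD1 i)//=.
under eq_uniform_expectation => p do rewrite -expr2.
rewrite (expectation_perm (fun k => w k ^+ 2)).
rewrite (eq_bigr _ sym) sumr_const (@eq_card _ _ (predC1 i)) // cardC1.
rewrite -[_ *+ #|T|.-1]mulr_natr -subn1 natrB ?(ltnW T2)// => total.
apply: (mulIf T1); apply: (addrI ((\sum_k w k ^+ 2) / #|T|%:R)).
by rewrite total; field; rewrite T0 T1.
Qed.

(** Expanding the square, each [i] in [A] gives one diagonal term and [#|A| - 1] mixed ones. With
    [A] a block, this is the second moment behind a block average. *)
Lemma expectation_perm_sum_sqr w (A : pred T) : (1 < #|T|)%N ->
  uniform_expectation (fun p : {perm T} => (\sum_(j | A j) w (p j)) ^+ 2) =
  #|A|%:R * ((\sum_k w k ^+ 2) / #|T|%:R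
    + (#|A|%:R - 1) * (((\sum_k w k) ^+ 2 - \sum_k w k ^+ 2)
                        / (#|T|%:R * (#|T|%:R - 1)))).
Proof.
move=> T2.
under eq_uniform_expectation => p.
  rewrite expr2 mulr_suml; under eq_bigr => i _ do rewrite mulr_sumr.
  over.
rewrite uniform_expectation_sum mulr_natl -sumr_const; apply: eq_bigr => i Ai.
rewrite uniform_expectation_sum (bigD1 i)//=; congr (_ + _).
  under eq_uniform_expectation => p do rewrite -expr2.
  exact: (expectation_perm (fun k => w k ^+ 2)).
under eq_bigr => j /andP[_ ji] do rewrite expectation_perm_mixed 1?eq_sym//.
rewrite sumr_const -[LHS]mulr_natl; congr (_ * _).
have -> : #|A| = #|[pred j | A j & j != i]|.+1.
  by rewrite (cardD1 i) (_ : i \in A)//; congr _.+1; apply: eq_card => j; rewrite !inE andbC.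
by rewrite -natr1 addrK.
Qed.

End PermutationMoments.

(** * One round: blocks, conservation of mass, contraction of the potential *)

Section Round.
Context {R : realType} {n K M : nat}.
Hypotheses (hn : n = (K * M)%N) (hK : (2 <= K)%N).
Variable H : {set 'I_M}.

Let K_gt0 : (0 < K)%N. Proof. exact: ltnW. Qed.

Let K_neq0 : K%:R != 0 :> R. Proof. by rewrite pnatr_eq0 -lt0n. Qed.

Lemma server_subproof (i : 'I_n) : (i %/ K < M)%N.
Proof. by rewrite ltn_divLR// mulnC -hn. Qed.

Definition server (i : 'I_n) : 'I_M := Ordinal (server_subproof i).

Lemma in_honest_blockE (i : 'I_n) : in_honest_block K H i = (server i \in H).
Proof.
apply/existsP/idP => [[m /andP[mH /eqP im]]|iH].
  by rewrite (_ : server i = m)//; apply: val_inj.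
by exists (server i); rewrite iH /=.
Qed.

(** As [n = K * M], no block is truncated: [r |-> m * K + r] maps ['I_K] onto the whole block. *)
Lemma card_block {m : nat} : (m < M)%N ->
  #|[pred j : 'I_n | (j %/ K == m)%N]| = K.
Proof.
move=> mM.
have lt (r : 'I_K) : (m * K + r < n)%N.
  rewrite hn [ltnRHS]mulnC (leq_trans _ (leq_mul mM (leqnn K)))//.
  by rewrite mulSn addnC ltn_add2r.
pose h (r : 'I_K) : 'I_n := Ordinal (lt r).
have hI : injective h by move=> r1 r2 [] /addnI/val_inj.
rewrite -[RHS]card_ord -(fintype.card_image hI); apply: eq_card => j; rewrite !inE.
apply/eqP/fintype.imageP => [jm|[r _ ->] /=].
  exists (Ordinal (ltn_pmod j K_gt0)) => //; apply: val_inj => /=.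
  by rewrite -jm -divn_eq.
by rewrite divnMDl// divn_small// addn0.
Qed.

Lemma card_honest_positions :
  #|[pred i : 'I_n | in_honest_block K H i]| = (#|H| * K)%N.
Proof.
rewrite -[LHS]sum1_card (partition_big server (mem H)) /=; last first.
  by move=> i; rewrite inE in_honest_blockE.
rewrite -sum_nat_const; apply: eq_bigr => m mH.
rewrite -[RHS](card_block (ltn_ord m)) -sum1_card; apply: eq_bigl => i.
rewrite !inE in_honest_blockE -val_eqE /=.
by apply/andP/eqP => [[_ /eqP]//|im]; rewrite im (_ : server i = m) ?mH//;
   apply: val_inj.
Qed.

(** After exchanging sums, each honest position [j] sends [w (p j) / K] to each of the [K] positions
    of its block. Total mass 1 therefore persists when rounds are iterated. *)
Lemma sum_mix_round (w : 'I_n -> R) (p : 'S_n) :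
  \sum_i mix_round K H w p i = \sum_i w i.
Proof.
rewrite -(sum_comp_perm w p) /mix_round.
rewrite (bigID (in_honest_block K H)) [RHS](bigID (in_honest_block K H)) /=.
congr (_ + _); last by apply: eq_bigr => i /negbTE->.
under eq_bigr => i -> do rewrite /block_average mulr_suml.
(* A position sharing its block with an honest position is honest. *)
rewrite (exchange_big_dep (in_honest_block K H)) /=; last first.
  by move=> i j; rewrite !in_honest_blockE => + /eqP ji;
     rewrite (_ : server j = server i)//; apply: val_inj.
apply: eq_bigr => j jH.
transitivity (#|[pred i : 'I_n | (i %/ K == j %/ K)%N]|%:R * (w (p j) / K%:R));
  last by rewrite (card_block (server_subproof j)) mulrC divfK.
rewrite mulr_natl -sumr_const; apply: eq_bigl => i.
rewrite inE eq_sym; apply/andP/eqP => [[_ /eqP]//|ij]; split; last exact/eqP.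
by move: jH; rewrite !in_honest_blockE (_ : server i = server j)//; apply: val_inj.
Qed.

(** The [#|H| * K] honest positions contribute the second moment of a block average, the others
    [S / n] each. The total minus [1 / n] is affine in [S] and vanishes at [S = 1 / n], hence is a
    multiple of the potential. *)
Lemma expectation_potential_mix_round (w : 'I_n -> R) : (1 < n)%N ->
  \sum_i w i = 1 ->
  uniform_expectation (fun p : 'S_n => potential (mix_round K H w p)) =
  (1 - #|H|%:R * (K%:R - 1) / (n%:R - 1)) * potential w.
Proof.
move=> n1 sw1; rewrite /potential uniform_expectationB.
rewrite (uniform_expectation_const (1%g : 'S_n)) uniform_expectation_sum.
set S := \sum_i w i ^+ 2.
have n0 : n%:R != 0 :> R by rewrite pnatr_eq0 -lt0n ltnW.
have n10 : n%:R - 1 != 0 :> R by rewrite subr_eq0 pnatr_eq1 gtn_eqF.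
rewrite (bigID (in_honest_block K H)) /=.
have -> : \sum_(i | in_honest_block K H i)
    uniform_expectation (fun p : 'S_n => mix_round K H w p i ^+ 2) =
  (#|H| * K)%:R * (K%:R^-1 * (S / n%:R + (K%:R - 1) *
     ((1 - S) / (n%:R * (n%:R - 1))))).
  rewrite mulr_natl -card_honest_positions -sumr_const; apply: eq_bigr => i iH.
  under eq_uniform_expectation => p do
    rewrite /mix_round iH /block_average exprMn mulrC.
  rewrite uniform_expectationZ.
  rewrite (expectation_perm_sum_sqr _ (fun j : 'I_n => j %/ K == i %/ K)%N);
    last by rewrite card_ord.
  rewrite (card_block (server_subproof i)) card_ord sw1 expr1n -/S.
  by field; rewrite K_neq0 n0 n10.
have -> : \sum_(i | ~~ in_honest_block K H i)
    uniform_expectation (fun p : 'S_n => mix_round K H w p i ^+ 2) =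
  (n%:R - (#|H| * K)%:R) * (S / n%:R).
  have -> : n%:R - (#|H| * K)%:R =
      #|[pred i : 'I_n | ~~ in_honest_block K H i]|%:R :> R.
    rewrite -card_honest_positions -[X in X%:R - _]card_ord.
    by rewrite -(cardC [pred i : 'I_n | in_honest_block K H i]) natrD addrC addKr.
  rewrite mulr_natl -sumr_const; apply: eq_bigr => i /negbTE iH.
  under eq_uniform_expectation => p do rewrite /mix_round iH.
  by rewrite (expectation_perm (fun k => w k ^+ 2)) card_ord.
by rewrite natrM; field; rewrite K_neq0 n0 n10.
Qed.

(** The induction peels off the first round, which changes the starting weights; hence the
    generality in [w]. *)
Lemma expectation_potential_foldl (t : nat) (w : 'I_n -> R) : (1 < n)%N ->
  \sum_i w i = 1 ->
  uniform_expectation (fun ps : t.-tuple 'S_n =>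
    potential (foldl (mix_round K H) w ps)) =
  (1 - #|H|%:R * (K%:R - 1) / (n%:R - 1)) ^+ t * potential w.
Proof.
move=> n1; elim: t w => [|t IH] w sw1.
  rewrite expr0 mul1r -[RHS](uniform_expectation_const ([tuple] : 0.-tuple 'S_n)).
  by apply: eq_uniform_expectation => ps; rewrite (tuple0 ps).
rewrite uniform_expectation_tupleS.
under eq_uniform_expectation => p do rewrite /= IH ?sum_mix_round//.
by rewrite uniform_expectationZ expectation_potential_mix_round// exprSr mulrA.
Qed.

Lemma expected_potentialE (t : nat) : (1 < n)%N ->
  expected_potential R n K H t =
  (1 - #|H|%:R * (K%:R - 1) / (n%:R - 1)) ^+ t * (1 - n%:R^-1).
Proof.
move=> n1; have n0 : (0 < n)%N by exact: ltnW.
have other (i : 'I_n) : i != Ordinal n0 -> initial_weight i = 0 :> R.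
  by rewrite -val_eqE /initial_weight /= => /negbTE->.
rewrite /expected_potential /mixnet_weight expectation_potential_foldl//.
  congr (_ * (_ - _)); rewrite (bigD1 (Ordinal n0))//= big1 ?addr0.
    by rewrite /initial_weight /= expr1n.
  by move=> i /other->; rewrite expr0n.
by rewrite (bigD1 (Ordinal n0))//= big1 ?addr0.
Qed.

End Round.

(** * From the contraction factor to the bounds after a rounded-up number of rounds *)

Lemma expr_ceiln_le (R : realType) (x rho b c : R) :
  1 <= x -> 0 < c -> 0 <= b -> 0 <= rho -> rho <= x `^ (- (1 / c)) ->
  rho ^+ ceiln (b * c) <= 1 / x `^ b.
Proof.
move=> x1 c0 b0 rho0 rhox.
have bc0 : 0 <= b * c by rewrite mulr_ge0// ltW.
have bct : b * c <= (ceiln (b * c))%:R.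
  (* The absolute value in [ceiln] is harmless because the ceiling of [b * c] is nonnegative. *)
  rewrite /ceiln natr_absz ger0_norm ?ceil_ge//.
  by rewrite ceil_ge0 (lt_le_trans _ bc0)// ltrN10.
apply: (@le_trans _ _ ((x `^ (- (1 / c))) ^+ ceiln (b * c))).
  by rewrite lerXn2r// nnegrE powR_ge0.
(* With [t] the number of rounds, the power is [x] to the [- t / c]; as [1 <= x], it suffices that
   [b <= t / c]. *)
rewrite -powR_mulrn ?powR_ge0// -powRrM !div1r -powRN ler_powR//.
by rewrite mulNr lerN2 mulrC ler_pdivlMr.
Qed.

Theorem theorem2 (R : realType) (n K M s : nat)
    (hn : n = (K * M)%N) (hK : (2 <= K)%N) (hM : (1 <= M)%N)
    (H : {set 'I_M}) (hH : #|H| = s) (hs : (1 <= s <= M)%N)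
    (b : R) (hb : 1 <= b) :
  (forall eps : R, 1 / 2 <= eps ->
     eps * ((n%:R - 1) / (K%:R - 1)) <= s%:R ->
     expected_potential R n K H (ceiln (b * log2 n%:R)) <= 1 / n%:R `^ b)
  /\
  (forall c : R, 1 <= c ->
     n%:R `^ (1 / c) <= K%:R ->
     M%:R - s%:R <= n%:R `^ (- (1 / c)) * (n%:R - 1) / (K%:R - 1)
                    - (n%:R - K%:R) / (K%:R * (K%:R - 1)) ->
     expected_potential R n K H (ceiln (b * c)) <= 1 / n%:R `^ b).
Proof.
have n1 : (1 < n)%N by rewrite hn (leq_trans hK)// leq_pmulr.
have K2R : 2 <= K%:R :> R by rewrite ler_nat.
have n2R : 2 <= n%:R :> R by rewrite ler_nat.
have nR : n%:R = K%:R * M%:R :> R by rewrite hn natrM.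
have sM : s%:R <= M%:R :> R by rewrite ler_nat; case/andP: hs.
have M1 : 1 <= M%:R :> R by rewrite ler1n.
have n1_gt0 : 0 < n%:R - 1 :> R by lra.
have K1_gt0 : 0 < K%:R - 1 :> R by lra.
set rho : R := 1 - s%:R * (K%:R - 1) / (n%:R - 1).
(* Since [s <= M], [s (K - 1) <= K M - M <= n - 1]. *)
have rho0 : 0 <= rho.
  rewrite subr_ge0 ler_pdivrMr// mul1r.
  by rewrite (le_trans (ler_wpM2r (ltW K1_gt0) sM))// nR; lra.
have bound c : 0 < c -> rho <= n%:R `^ (- (1 / c)) ->
    expected_potential R n K H (ceiln (b * c)) <= 1 / n%:R `^ b.
  move=> c0 rhoc; rewrite (expected_potentialE hn hK)// hH -/rho.
  have nV0 : 0 <= (n%:R^-1 : R) by rewrite invr_ge0.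
  apply: (@le_trans _ _ (rho ^+ ceiln (b * c))).
    by rewrite ler_piMr ?exprn_ge0// lerBlDr lerDl.
  by apply: expr_ceiln_le => //; lra.
split=> [eps eps2 hseps|c c1 _ hMs].
- have ln2 : 0 < ln 2 :> R by rewrite ln_gt0// ltr1n.
  have lnn : 0 < ln n%:R :> R by rewrite ln_gt0//; lra.
  apply: bound; first by rewrite divr_gt0.
  (* The choice [c = log2 n] turns the required bound into [rho <= 1 / 2]. *)
  have -> : n%:R `^ (- (1 / log2 n%:R)) = 2^-1 :> R.
    rewrite powRN /powR gt_eqF ?(lt_trans ltr01)//; last by lra.
    by rewrite /log2 div1r invf_div divfK ?gt_eqF// lnK ?posrE.
  suff : 2^-1 <= s%:R * (K%:R - 1) / (n%:R - 1) :> R by rewrite /rho => ?; lra.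
  rewrite ler_pdivlMr// -ler_pdivrMr// -mulrA (le_trans _ hseps)//.
  by apply: ler_wpM2r; [exact/ltW/divr_gt0|lra].
- apply: bound; first by lra.
  have K0 : K%:R != 0 :> R by rewrite gt_eqF//; lra.
  rewrite /rho; set y := n%:R `^ _ in hMs *.
  have : (M%:R - s%:R) * (K%:R - 1) <=
      y * (n%:R - 1) - (n%:R - K%:R) / K%:R.
    rewrite -ler_pdivlMr// (le_trans hMs)// le_eqVlt; apply/orP; left.
    by apply/eqP; field; rewrite K0 gt_eqF.
  (* The hypothesis becomes [(M - s) (K - 1) + (M - 1) <= y (n - 1)], whose left side is
     [(n - 1) - s (K - 1) = rho (n - 1)]. *)
  have -> : (n%:R - K%:R) / K%:R = M%:R - 1 :> R by rewrite nR; field.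
  rewrite lerBlDr -lerBlDl ler_pdivlMr// nR; lra.
Qed.
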